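(* Let $G$ be a graph, let $x$ be a vertex of $G$, and let $e=uv$ be an edge of $G$. (1) Assuming $G-x$ contains an edge, $\operatorname{th}_{\operatorname{Z}}^{\ast}(G)-1\le \operatorname{th}_{\operatorname{Z}}^{\ast}(G-x)\le \operatorname{th}_{\operatorname{Z}}^{\ast}(G)$. (2) Assuming $G-e$ contains an edge, $\operatorname{th}_{\operatorname{Z}}^{\ast}(G)-1\le \operatorname{th}_{\operatorname{Z}}^{\ast}(G-e)\le \operatorname{th}_{\operatorname{Z}}^{\ast}(G)+1$. (3) Assuming $G/e$ contains an edge, $\operatorname{th}_{\operatorname{Z}}^{\ast}(G)-1\le \operatorname{th}_{\operatorname{Z}}^{\ast}(G/e)\le \operatorname{th}_{\operatorname{Z}}^{\ast}(G)$. (4) $\operatorname{th}_{\operatorname{Z}}^{\ast}(G)\le \operatorname{th}_{\operatorname{Z}}^{\ast}(G_e)\le \operatorname{th}_{\operatorname{Z}}^{\ast}(G)+1$. These bounds are sharp (that is, for each of the eight inequalities there exist a graph and a choice of vertex $x$ or edge $e$, as relevant, satisfying the stated assumption, for which equality holds).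
   Context: All graphs are finite, simple and undirected. Graph operations: $G-x$ is obtained from $G$ by deleting the vertex $x$ and all edges incident to $x$; $G-e$ by deleting the edge $e$; the contraction $G/e$ by identifying $u$ and $v$ and suppressing any loops or multiple edges that arise; the subdivision $G_e$ by adding a new vertex $z$, adding the edges $uz$ and $vz$, and removing the edge $e=uv$. Standard zero forcing: start with a set $B\subseteq V(G)$ of filled vertices, all other vertices being unfilled. In each time step, every vertex $w$ for which there is a filled vertex $v$ (filled at the end of the previous time step) such that $w$ is the unique unfilled neighbor of $v$ becomes filled (all such fillings are performed simultaneously). Let $B^{[0]}=B$ and let $B^{[i]}$ be the set of vertices filled after time step $i$. The propagation time $\operatorname{pt}_{\operatorname{Z}}(G,B)$ is the least $t\ge 0$ with $B^{[t]}=V(G)$, and is $\infty$ if no such $t$ exists. The no initial cost product throttling number for standard zero forcing, defined for a graph $G$ of order $n$ that has an edge, is $$\operatorname{th}_{\operatorname{Z}}^{\ast}(G)=\min_{1\le k\le n-1}\ \min_{B\subseteq V(G),\,|B|=k}|B|\operatorname{pt}_{\operatorname{Z}}(G,B).$$ *)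

(* Defs.v *)
From mathcomp Require Import all_boot all_order all_algebra.
From mathcomp Require Import boolp constructive_ereal.

Set Implicit Arguments.
Unset Strict Implicit.
Unset Printing Implicit Defensive.

Record sgraph := SGraph {
  vertex :> finType;
  adj : rel vertex;
  adj_sym : symmetric adj;
  adj_irr : irreflexive adj }.

Definition has_edge (G : sgraph) : Prop := exists a b : G, adj a b.

Section Operations.
Variable G : sgraph.

Section DeleteVertex.
Variable x : G.
Let V := {y : G | y != x}.
Definition del_vertex_adj : rel V := fun a b => adj (val a) (val b).
Lemma del_vertex_sym : symmetric del_vertex_adj.
Proof. by move=> a b; rewrite /del_vertex_adj adj_sym. Qed.
Lemma del_vertex_irr : irreflexive del_vertex_adj.
Proof. by move=> a; rewrite /del_vertex_adj adj_irr. Qed.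
Definition del_vertex : sgraph := SGraph del_vertex_sym del_vertex_irr.
End DeleteVertex.

Variables u v : G.

Definition del_edge_adj : rel G :=
  fun a b => adj a b && ([set a; b] != [set u; v]).
Lemma del_edge_sym : symmetric del_edge_adj.
Proof. by move=> a b; rewrite /del_edge_adj adj_sym setUC. Qed.
Lemma del_edge_irr : irreflexive del_edge_adj.
Proof. by move=> a; rewrite /del_edge_adj adj_irr. Qed.
Definition del_edge : sgraph := SGraph del_edge_sym del_edge_irr.

(* Here u stands for the vertex obtained by identifying u and v.
   This is only meaningful for u != v, in particular when uv is an edge. *)
Definition contract_rep (y : G) : G := if y == v then u else y.
Definition contract_edge_adj : rel {y : G | y != v} := fun a b =>
  (a != b) && [exists a' : G, exists b' : G,
    [&& contract_rep a' == val a, contract_rep b' == val b & adj a' b']].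
Lemma contract_sym : symmetric contract_edge_adj.
Proof.
suff H a b : contract_edge_adj a b -> contract_edge_adj b a.
  by move=> a b; apply/idP/idP; apply: H.
case/andP=> nab /existsP[a' /existsP[b' /and3P[ea eb ab]]].
rewrite /contract_edge_adj eq_sym nab; apply/existsP; exists b'.
by apply/existsP; exists a'; rewrite ea eb adj_sym ab.
Qed.
Lemma contract_irr : irreflexive contract_edge_adj.
Proof. by move=> a; rewrite /contract_edge_adj eqxx. Qed.
Definition contract_edge : sgraph := SGraph contract_sym contract_irr.

(* None is the new vertex subdividing uv. *)
Definition subdivide_adj : rel (option G) := fun a b =>
  match a, b with
  | Some a', Some b' => del_edge_adj a' b'
  | Some y, None | None, Some y => (y == u) || (y == v)
  | None, None => false
  end.
Lemma subdivide_sym : symmetric subdivide_adj.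
Proof. by move=> [a|] [b|] //=; apply: del_edge_sym. Qed.
Lemma subdivide_irr : irreflexive subdivide_adj.
Proof. by move=> [a|] //=; apply: del_edge_irr. Qed.
Definition subdivide_edge : sgraph := SGraph subdivide_sym subdivide_irr.

End Operations.

Section ZeroForcing.
Variable G : sgraph.
Implicit Types B : {set G}.

Definition nbrs (y : G) : {set G} := [set w | adj y w].

Definition zf_step B : {set G} :=
  B :|: [set w | [exists y in B, nbrs y :\: B == [set w]]].

Definition filled B (t : nat) : {set G} := iter t zf_step B.

Local Open Scope ereal_scope.

(* Values are natural numbers or +oo; \bar int supplies min, * and <= with +oo. *)
Definition pt B : \bar int :=
  if pselect (exists t, filled B t == [set: G]) is left h
  then (ex_minn h)%:Z%:E else +oo.

Definition th_star : \bar int :=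
  \big[mine/+oo]_(1 <= k < #|G|)
    \big[mine/+oo]_(B : {set G} | #|B| == k) (#|B|%:Z%:E * pt B).

End ZeroForcing.

(* Main.v *)
Require Import Defs.
From mathcomp Require Import all_boot all_order all_algebra.
From mathcomp Require Import boolp constructive_ereal.
From mathcomp Require Import zify.

Set Implicit Arguments.
Unset Strict Implicit.
Unset Printing Implicit Defensive.

Import Order.TTheory GRing.Theory Num.Theory.

(* Call W forceable if every w in W has a neighbor outside W whose only
   neighbor in W is w, and let m be the largest size of a forceable set.  Then
   th* = n - m.  Indeed V \ W fills W in one step; conversely, if B fills the
   graph in t steps, the vertices filled in the first step form a forceable set,
   and each of the other t - 1 steps fills at most #|B| vertices, so that
   n <= m + t #|B|.  Deleting a vertex lowers m by at most 1 and never raises it,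
   deleting an edge changes m by at most 1, and contracting an edge lowers m by
   at most 1 and never raises it.  The subdivision case is the contraction case
   applied to the new edge uz of G_e.  Since m <= n / 2, the values of m
   for small paths are forced. *)

(** * Forceable sets and the value of th* *)

Section Forceable.
Variable G : sgraph.
Implicit Types W S B : {set G}.

Definition forceable W : bool :=
  [forall w in W, exists v in ~: W, [forall y in W, adj v y == (y == w)]].

Definition force_num : nat := \max_(W | forceable W) #|W|.

Lemma forceableP W :
  reflect (forall w, w \in W ->
             exists2 v, v \notin W & {in W, forall y, adj v y = (y == w)})
          (forceable W).
Proof.
apply: (iffP forall_inP) => H w /H.
  case/exists_inP=> v; rewrite inE => vW /forall_inP vw.
  by exists v => // y /vw/eqP.
case=> v vW vw; apply/exists_inP; exists v; first by rewrite inE.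
by apply/forall_inP => y /vw ->.
Qed.

Lemma leq_force_num W : forceable W -> #|W| <= force_num.
Proof. exact: leq_bigmax_cond. Qed.

Lemma force_num_attained : exists2 W, forceable W & force_num = #|W|.
Proof.
have F0 : forceable set0 by apply/forceableP => w; rewrite inE.
have [|W] := @eq_bigmax_cond _ [pred W | forceable W] (fun W => #|W|).
  by apply/card_gt0P; exists set0; rewrite inE.
by rewrite inE => FW eW; exists W.
Qed.

(** The filled vertices that can still force, now or later; their number is the potential that
    bounds how many vertices a step fills. *)
Definition active S : {set G} := [set v in S | nbrs v :\: S != set0].

Lemma zf_step_forcer S w : w \in zf_step S :\: S ->
  exists2 v, v \in S & nbrs v :\: S = [set w].
Proof.
rewrite !inE => /andP[/negPf wS]; rewrite wS /=.
by case/exists_inP=> v vS /eqP; exists v.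
Qed.

(** The forcer of a new vertex has a single neighbor outside [S], hence a single one among the new
    vertices. *)
Lemma forceable_step S : forceable (zf_step S :\: S).
Proof.
apply/forceableP => w /zf_step_forcer[v vS vw].
exists v; first by rewrite inE vS.
move=> y; rewrite inE => /andP[yS _].
by move/setP: vw => /(_ y); rewrite !inE yS.
Qed.

Lemma step_forceable W : forceable W -> zf_step (~: W) = [set: G].
Proof.
move/forceableP => FW; apply/setP => w; rewrite !inE.
have [wW|//] := boolP (w \in W); have [v vW vw] := FW w wW.
apply/exists_inP; exists v; first by rewrite inE.
apply/eqP/setP => y; rewrite !inE negbK.
have [/vw->//|yW] := boolP (y \in W).
by apply/esym/eqP => eyw; rewrite eyw wW in yW.
Qed.

(* A vertex that forces at this step stops being active, so the newly filled
   vertices are paid for by their forcers. *)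
Lemma active_step S :
  #|zf_step S :\: S| <= #|active S| /\ #|active (zf_step S)| <= #|active S|.
Proof.
set N := zf_step S :\: S.
(* [f] chooses a forcer for each new vertex; it is injective because the unfilled neighborhood of a
   forcer is exactly the vertex it forces. *)
pose f w := odflt w [pick v in S | nbrs v :\: S == [set w]].
have fP w : w \in N -> f w \in S /\ nbrs (f w) :\: S = [set w].
  move=> /zf_step_forcer[v vS vw]; rewrite /f.
  by case: pickP => [u /andP[uS /eqP]|/(_ v)]; last rewrite vS vw eqxx.
have f_inj : {in N &, injective f}.
  move=> a b /fP[_ ea] /fP[_ eb] eab.
  by apply: set1_inj; rewrite -ea -eb eab.
have fN : f @: N \subset active S.
  apply/subsetP => _ /imsetP[w /fP[fS fw] ->].
  by rewrite inE fS fw; apply/set0Pn; exists w; rewrite inE.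
have cardfN := card_in_imset f_inj; split; first by rewrite -cardfN subset_leq_card.
(* A vertex active afterwards is new, or was active and not a chosen forcer: the only unfilled
   neighbor of a forcer has just been filled. *)
have sub : active (zf_step S) \subset (active S :\: f @: N) :|: N.
  apply/subsetP => v; rewrite inE => /andP[vS' /set0Pn[y]].
  rewrite inE => /andP[yS' vy].
  have yS : y \notin S by apply: contra yS'; rewrite inE => ->.
  have [vS|vS] := boolP (v \in S); last by apply/setUP; right; rewrite in_setD vS.
  apply/setUP; left; rewrite inE [in X in _ && X]inE vS /=.
  apply/andP; split; last by apply/set0Pn; exists y; rewrite inE yS.
  apply/imsetP => -[w wN evw]; have [_ fw] := fP w wN.
  have : y \in nbrs (f w) :\: S by rewrite inE yS -evw.
  rewrite fw inE => /eqP eyw.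
  by rewrite eyw in yS'; move: wN; rewrite inE (negPf yS') andbF.
have := leq_trans (subset_leq_card sub) (leq_card_setU _ _).
rewrite cardsDS // cardfN; have := subset_leq_card fN; rewrite cardfN; lia.
Qed.

Lemma active_filled B t : #|active (filled B t)| <= #|B|.
Proof.
elim: t => [|t IH]; last exact: leq_trans (active_step _).2 IH.
by apply: subset_leq_card; apply/subsetP => v; rewrite inE => /andP[].
Qed.

Lemma card_zf_step S : #|zf_step S| = #|S| + #|zf_step S :\: S|.
Proof. by rewrite -(cardsID S) (setIidPr (subsetUl _ _)). Qed.

(** The factor [t.+1] counts [B] itself and the [t] steps after the first; the first step is charged
    to [force_num]. *)
Lemma card_filled B t : #|filled B t.+1| <= force_num + #|B| * t.+1.
Proof.
elim: t => [|t IH].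
  rewrite /= card_zf_step; have := leq_force_num (forceable_step B); lia.
rewrite [filled B _]/= card_zf_step -[zf_step (filled B t)]/(filled B t.+1).
have := leq_trans (active_step (filled B t.+1)).1 (active_filled B t.+1); lia.
Qed.

(** Starting from [~: W], one step fills all of [W], and each new vertex is paid for by its own
    active vertex in [~: W]. *)
Lemma force_num_half : 2 * force_num <= #|G|.
Proof.
have [W FW ->] := force_num_attained.
have [+ _] := active_step (~: W); rewrite step_forceable // setDE setTI setCK.
have := active_filled (~: W) 0; rewrite /= -(cardsC W); lia.
Qed.

Lemma force_num_gt0 : has_edge G -> 0 < force_num.
Proof.
case=> a [b ab]; rewrite -(cards1 b); apply: leq_force_num.
apply/forceableP => w /set1P->; exists a.
  by apply/set1P => eab; rewrite eab adj_irr in ab.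
by move=> y /set1P->; rewrite ab eqxx.
Qed.

Lemma pt_le B t : filled B t = [set: G] -> (pt B <= t%:Z%:E)%E.
Proof.
move=> ft; rewrite /pt; case: pselect => [h|[]]; last by exists t; rewrite ft.
by case: ex_minnP => m _ /(_ t); rewrite ft eqxx lee_fin lez_nat; apply.
Qed.

Lemma pt_ge B : 0 < #|B| < #|G| ->
  ((#|G| - force_num)%N%:Z%:E <= #|B|%:Z%:E * pt B)%E.
Proof.
case/andP=> B0 Blt; rewrite /pt; case: pselect => [h|h]; last first.
  by rewrite gt0_muley ?leey // lte_fin ltz_nat.
(* Time 0 would mean that [B] is the whole vertex set, so the time is a successor and [card_filled]
   applies. *)
case: ex_minnP => -[|t] /eqP ft _.
  by move: Blt; rewrite -[B]/(filled B 0) ft cardsT ltnn.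
have := card_filled B t; rewrite ft cardsT -EFinM lee_fin; lia.
Qed.

Lemma th_starE : has_edge G -> th_star G = (#|G| - force_num)%N%:Z%:E.
Proof.
move=> /force_num_gt0 m0; apply/le_anti/andP; split; last first.
  rewrite /th_star big_nat_cond; apply: le_bigmin; first exact: leey.
  move=> k; rewrite andbT => /andP[k0 kn].
  apply: le_bigmin => [|B /eqP Bk]; first exact: leey.
  by apply: pt_ge; rewrite Bk k0.
(* The minimum is reached at the complement of a largest forceable set; [0 < force_num] and
   [force_num_half] place its size between 1 and [#|G| - 1]. *)
have [W FW eW] := force_num_attained; have half := force_num_half.
have cW : #|~: W| = #|G| - force_num by have := cardsC W; lia.
apply: (@bigmin_inf_seq _ _ _ _ _ (#|G| - force_num)) => //.
  by rewrite mem_index_iota; lia.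
apply: (@bigmin_inf _ _ _ _ (~: W)); first exact/eqP.
have /pt_le/(lee_wpmul2l (x := #|~: W|%:Z%:E)) : filled (~: W) 1 = [set: G].
  exact: step_forceable.
by rewrite lee_fin => /(_ isT)/le_trans; apply; rewrite -EFinM mulr1 cW.
Qed.

End Forceable.

(** A pattern on four vertices that can be checked by enumeration in small graphs: [c] forces [a]
    and [d] forces [b], and the two inequalities keep the forcers outside the pair. *)
Lemma force_num_ge2P (G : sgraph) :
  (exists a b c d : G, [/\ adj c a, ~~ adj c b, adj d b, ~~ adj d a
     & (c != b) && (d != a)])
  <-> 2 <= force_num G.
Proof.
split.
  case=> a [b [c [d [ca cb db da /andP[nb na]]]]].
  have ab : a != b by apply: contraTneq ca => ->.
  rewrite -[2]/(1.+1) -[X in X <= _](_ : #|[set a; b]| = _); last by rewrite cards2 ab.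
  apply/leq_force_num/forceableP => w /set2P[]->.
    exists c.
      by rewrite !inE negb_or nb andbT; apply: contraTneq ca => ->; rewrite adj_irr.
    by move=> y /set2P[]->; rewrite ?ca ?(negPf cb) ?eqxx // eq_sym (negPf ab).
  exists d.
    by rewrite !inE negb_or na; apply: contraTneq db => ->; rewrite adj_irr.
  by move=> y /set2P[]->; rewrite ?db ?(negPf da) ?eqxx // (negPf ab).
have [W /forceableP FW ->] := force_num_attained G.
case/card_gt1P=> a [b [aW bW ab]].
have [c cW ca] := FW a aW; have [d dW db] := FW b bW.
exists a, b, c, d; rewrite ca ?ca ?db ?eqxx // [b == a]eq_sym ab; split=> //.
by apply/andP; split; [apply: contraNneq cW | apply: contraNneq dW] => ->.
Qed.

(** An induced embedding carries a forceable set together with its forcers. *)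
Lemma force_num_embed (G H : sgraph) (f : G -> H) : injective f ->
  {mono f : a b / adj a b} -> force_num G <= force_num H.
Proof.
move=> f_inj f_adj; have [W /forceableP FW ->] := force_num_attained G.
rewrite -(card_imset _ f_inj); apply/leq_force_num/forceableP.
move=> _ /imsetP[w /FW[v vW vw] ->]; exists (f v); first by rewrite mem_imset.
by move=> _ /imsetP[y yW ->]; rewrite f_adj vw // inj_eq.
Qed.

Lemma leq_cardsD1 (T : finType) (a : T) (W : {set T}) : #|W| <= #|W :\ a|.+1.
Proof. by rewrite (cardsD1 a W) -add1n leq_add2r leq_b1. Qed.

(** Transfers a set avoiding [v] to the vertex type of a deletion or contraction without losing
    size. *)
Lemma card_val_preim (T : finType) (v : T) (W : {set T}) : v \notin W ->
  #|[set a : {y : T | y != v} | val a \in W]| = #|W|.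
Proof.
move=> vW; rewrite -(card_imset _ val_inj); apply: eq_card => y.
apply/imsetP/idP => [[a] + ->|yW]; first by rewrite inE.
have yv : y != v by apply: contraNneq vW => <-.
by exists (Sub y yv); rewrite // inE.
Qed.

(** * Vertex deletion *)

Section DelVertex.
Variables (G : sgraph) (x : G).

Lemma force_num_del_vertex_le : force_num (del_vertex x) <= force_num G.
Proof. exact: (@force_num_embed (del_vertex x) G val val_inj). Qed.

Lemma force_num_del_vertex_ge : force_num G <= (force_num (del_vertex x)).+1.
Proof.
have [W /forceableP FW ->] := force_num_attained G.
(* It is enough to drop at most one vertex so that [x] is neither kept nor the forcer of a kept
   vertex: drop [x] if it lies in [W], else the vertex [x] forces, if any. *)
suff [W0 [sW0 xW0 cW0 FW0]] : exists W0 : {set G}, [/\ W0 \subset W, x \notin W0,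
    #|W| <= #|W0|.+1 & forall w v, w \in W0 -> v \notin W ->
      {in W, forall y, adj v y = (y == w)} -> v != x].
  apply: leq_trans cW0 _; rewrite ltnS -(card_val_preim xW0).
  apply: leq_force_num; apply/forceableP => w; rewrite inE => wW0.
  have [v vW vw] := FW _ (subsetP sW0 _ wW0).
  have vx := FW0 _ _ wW0 vW vw; exists (Sub v vx).
    by rewrite inE; apply: contra vW => /(subsetP sW0).
  by move=> y; rewrite inE => yW0; rewrite -val_eqE -vw // (subsetP sW0).
have [xW|xW] := boolP (x \in W).
  exists (W :\ x); rewrite subsetDl leq_cardsD1 !inE eqxx; split=> // w v _ vW _.
  by apply: contraNneq vW => ->.
have [/exists_inP[a aW /forall_inP xa]|none] :=
  boolP [exists a in W, forall y in W, adj x y == (y == a)].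
  exists (W :\ a); rewrite subsetDl leq_cardsD1 !inE (negPf xW) andbF; split=> // w v.
  rewrite !inE => /andP[wa wW] _ vw; apply: contra wa => /eqP evx.
  by rewrite -(eqP (xa _ wW)) -evx vw.
exists W; split=> // w v wW _ vw; apply: contra none => /eqP <-.
by apply/exists_inP; exists w => //; apply/forall_inP => y /vw ->.
Qed.
End DelVertex.

(** * Edge deletion *)

Lemma eq_set2 (T : finType) (a b u v : T) : ([set a; b] == [set u; v]) =
  (a == u) && (b == v) || (a == v) && (b == u).
Proof.
apply/eqP/idP => [e|/orP[]/andP[/eqP-> /eqP->]] //; last by rewrite setUC.
have := set22 u v; have := set21 u v; rewrite -e.
have := set22 a b; have := set21 a b; rewrite {1 2}e.
by do 4![case/set2P=> ?]; subst; rewrite ?eqxx ?orbT.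
Qed.

(** Only the pair [u], [v] may change, so dropping one endpoint keeps every forcer valid. The
    symmetric form covers both removing and adding an edge. *)
Lemma force_num_edge_change (T : finType) (e e' : rel T)
    (es : symmetric e) (ei : irreflexive e) (es' : symmetric e')
    (ei' : irreflexive e') (u v : T) :
  (forall a b, [set a; b] != [set u; v] -> e a b = e' a b) ->
  force_num (SGraph es ei) <= (force_num (SGraph es' ei')).+1.
Proof.
move=> ee'; have [W /forceableP FW ->] := force_num_attained (SGraph es ei).
(* If [u] is in [W], it is dropped and is no forcer; otherwise, after dropping [v], neither endpoint
   remains. Either way no forcer and kept vertex form the pair [u], [v]. *)
pose z := if u \in W then u else v.
apply: leq_trans (leq_cardsD1 z W) _; rewrite ltnS.
apply: (@leq_force_num (SGraph es' ei')); apply/forceableP => w.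
rewrite !inE => /andP[wz wW]; have [f fW fw] := FW w wW.
exists f; first by rewrite !inE (negPf fW) andbF.
move=> y; rewrite !inE => /andP[yz yW]; rewrite -fw //=; apply/esym/ee'.
rewrite eq_set2; move: yz fW; rewrite /z; case: ifP => uW yz fW.
  by rewrite (negPf yz) andbF orbF; apply/andP => -[/eqP fu _]; rewrite fu uW in fW.
rewrite (negPf yz) andbF /=; apply/andP => -[_ /eqP yu]; by rewrite yu uW in yW.
Qed.

Section DelEdge.
Variables (G : sgraph) (u v : G).

Lemma del_edge_adjE a b :
  [set a; b] != [set u; v] -> adj a b = del_edge_adj u v a b.
Proof. by rewrite /del_edge_adj => ->; rewrite andbT. Qed.

Lemma force_num_del_edge_ge : force_num G <= (force_num (del_edge u v)).+1.
Proof.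
exact: (force_num_edge_change (@adj_sym G) (@adj_irr G)
  (del_edge_sym u v) (del_edge_irr u v) del_edge_adjE).
Qed.

Lemma force_num_del_edge_le : force_num (del_edge u v) <= (force_num G).+1.
Proof.
apply: (force_num_edge_change (del_edge_sym u v) (del_edge_irr u v)
  (@adj_sym G) (@adj_irr G)) => a b /del_edge_adjE; exact: esym.
Qed.
End DelEdge.

(** * Edge contraction *)

Section ContractEdge.
Variables (G : sgraph) (u v : G).
Hypothesis uv : adj u v.

Let u_neq_v : u != v.
Proof. by apply: contraTneq uv => ->; rewrite adj_irr. Qed.

Let us : contract_edge u v := Sub u u_neq_v.

Lemma contract_adjE (a b : contract_edge u v) : adj a b = (a != b) &&
  [|| adj (val a) (val b), (val a == u) && adj v (val b)
    | (val b == u) && adj (val a) v].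
Proof.
rewrite [LHS]/= /contract_edge_adj; case: (a =P b) => //= /eqP ab.
apply/existsP/idP =>
  [[a' /existsP[b' /and3P[]]]|/or3P[h|/andP[/eqP au h]|/andP[/eqP bu h]]].
- rewrite /contract_rep; case: (a' =P v) => [->|_] /eqP ea;
    case: (b' =P v) => [->|_] /eqP eb.
  + by rewrite adj_irr.
  + by move=> h; rewrite -ea -eb eqxx h orbT.
  + by move=> h; rewrite -ea -eb eqxx h !orbT.
  + by rewrite ea eb => ->.
- exists (val a); apply/existsP; exists (val b); rewrite /contract_rep.
  by rewrite (negPf (valP a)) (negPf (valP b)) !eqxx.
- exists v; apply/existsP; exists (val b); rewrite /contract_rep.
  by rewrite (negPf (valP b)) !eqxx au eqxx.
exists (val a); apply/existsP; exists v; rewrite /contract_rep.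
by rewrite (negPf (valP a)) !eqxx bu eqxx.
Qed.

Lemma force_num_contract_le : force_num (contract_edge u v) <= force_num G.
Proof.
have [W /forceableP FW ->] := force_num_attained (contract_edge u v).
(* [fr r] lifts the contraction to [G], sending the merged vertex to an endpoint [r] to be
   chosen. *)
pose fr (r : G) (y : contract_edge u v) := if y == us then r else val y.
have val_r r (z : contract_edge u v) :
    (r == u) || (r == v) -> z != us -> r != val z.
  case/orP=> /eqP-> zu; last by rewrite eq_sym (valP z).
  by rewrite -[u]/(val us) val_eqE eq_sym.
have fr_inj r : (r == u) || (r == v) -> injective (fr r).
  move=> ruv y z; rewrite /fr.
  case: (y =P us) => [->|/eqP yu]; case: (z =P us) => [->|/eqP zu] // e.
  - by have := val_r r z ruv zu; rewrite e eqxx.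
  - by have := val_r r y ruv yu; rewrite -e eqxx.
  - exact: val_inj.
suff [r ruv Fr] : exists2 r, (r == u) || (r == v) & forceable (fr r @: W).
  by rewrite -(card_imset W (fr_inj r ruv)); exact: leq_force_num.
have val_u (y : contract_edge u v) : (val y == u) = (y == us) by [].
have forced r w f : (r == u) || (r == v) -> f != us -> f \notin W ->
    {in W, forall y, adj f y = (y == w)} ->
    (us \in W -> adj (val f) r = (us == w)) ->
    exists2 g, g \notin fr r @: W &
      {in fr r @: W, forall z, adj g z = (z == fr r w)}.
  move=> ruv fu fW fw fr_us; exists (val f).
    apply/imsetP => -[y yW]; rewrite /fr; case: eqP => [_ e|_ /val_inj e].
      by have := val_r r f ruv fu; rewrite e eqxx.
    by rewrite e yW in fW.
  move=> _ /imsetP[y yW ->]; rewrite (inj_eq (fr_inj r ruv)) {1}/fr.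
  case: eqP => [yu|/eqP yu]; first by rewrite yu in yW *; exact: fr_us.
  rewrite -fw // contract_adjE !val_u (negPf fu) (negPf yu) !orbF.
  by case: eqP => // fy; rewrite fy yW in fW.
(* If the merged vertex is in [W], [r] is an endpoint adjacent to its forcer; the forcers of other
   vertices are adjacent to neither endpoint. *)
have [usW|usW] := boolP (us \in W).
  have not_us f : f \notin W -> f != us by apply: contraNneq => ->.
  have [f fW fus] := FW us usW.
  have [r ruv fr1] : exists2 r, (r == u) || (r == v) & adj (val f) r.
    have := fus us usW; rewrite eqxx contract_adjE val_u.
    rewrite (negPf (not_us f fW)) eqxx /= => /orP[h|h].
      by exists u; rewrite // eqxx.
    by exists v; rewrite // eqxx orbT.
  exists r => //; apply/forceableP => _ /imsetP[w wW ->].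
  have [->|wus] := eqVneq w us.
    by apply: (forced r us f) => //; [exact: not_us|rewrite fr1 eqxx].
  have [g gW gw] := FW w wW; apply: (forced r w g) => //; first exact: not_us.
  move=> _; rewrite eq_sym (negPf wus); have := gw us usW.
  rewrite eq_sym (negPf wus) contract_adjE (not_us g gW) val_u.
  rewrite (negPf (not_us g gW)) eqxx /= => /negbT.
  by rewrite negb_or => /andP[/negPf gu /negPf gv]; case/orP: ruv => /eqP->.
exists u; first by rewrite eqxx.
apply/forceableP => _ /imsetP[w wW ->]; have [f fW fw] := FW w wW.
have [fu|fu] := eqVneq f us; last by apply: (forced u w f); rewrite ?eqxx // (negPf usW).
have frE y : y \in W -> fr u y = val y.
  by rewrite /fr; case: eqP => // ->; rewrite (negPf usW).
have adj_us y : y \in W -> adj u (val y) || adj v (val y) = (y == w).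
  move=> yW; have yus : us != y by apply: contraNneq usW => ->.
  by rewrite -fw // fu contract_adjE yus !val_u eqxx [y == us]eq_sym (negPf yus) orbF.
(* When the merged vertex forces [w], some endpoint is adjacent to [w], and neither is adjacent to
   another vertex of [W]; that endpoint replaces it as forcer. *)
have [r ruv rw] : exists2 r, (r == u) || (r == v) & adj r (val w).
  have := adj_us w wW; rewrite eqxx => /orP[h|h]; [exists u|exists v] => //.
    by rewrite eqxx.
  by rewrite eqxx orbT.
exists r.
  apply/imsetP => -[y yW]; rewrite frE // => e.
  have yus : y != us by apply: contraNneq usW => <-.
  by have := val_r r y ruv yus; rewrite e eqxx.
move=> _ /imsetP[y yW ->]; rewrite !frE // val_eqE.
have [->|yw] := eqVneq y w; first by rewrite rw.
have := adj_us y yW; rewrite (negPf yw) => /negbT.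
by rewrite negb_or => /andP[/negPf yu /negPf yv]; case/orP: ruv => /eqP->.
Qed.

Lemma force_num_contract_ge : force_num G <= (force_num (contract_edge u v)).+1.
Proof.
have [W /forceableP FW ->] := force_num_attained G.
suff [W0 [sW0 vW0 cW0 FW0]] : exists W0 : {set G}, [/\ W0 \subset W, v \notin W0,
    #|W| <= #|W0|.+1 & forall w f, w \in W0 -> f \notin W ->
      {in W, forall y, adj f y = (y == w)} ->
      f != v /\
      {in W0, forall y, (f == u) && adj v y || (y == u) && adj f v = false}].
  apply: leq_trans cW0 _; rewrite ltnS -(card_val_preim vW0).
  apply: (@leq_force_num (contract_edge u v)); apply/forceableP => w; rewrite inE => wW0.
  have [f fW fw] := FW _ (subsetP sW0 _ wW0).
  have [fv fy] := FW0 _ _ wW0 fW fw; exists (Sub f fv).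
    by rewrite inE; apply: contra fW => /(subsetP sW0).
  move=> y; rewrite inE => yW0; have yW := subsetP sW0 _ yW0.
  rewrite contract_adjE /= fy // orbF -[y == w]val_eqE -fw // -val_eqE /=.
  by case: eqP => //= fyE; rewrite fyE yW in fW.
have Wf (a b f : G) : a \in W -> adj f a ->
    {in W, forall y, adj f y = (y == b)} -> a = b.
  by move=> aW fa /(_ a aW); rewrite fa => /esym/eqP.
have self f w : w \in W -> {in W, forall y, adj f y = (y == w)} -> adj f w.
  by move=> wW ->.
(* W0 drops v, else u, else the vertex forced by v, else the one forced by u;
   in each case the merged vertex inherits no unwanted adjacency. *)
have [vW|vW] := boolP (v \in W).
  exists (W :\ v); rewrite subsetDl leq_cardsD1 !inE eqxx; split=> // w f.
  rewrite !inE => /andP[wv wW] fW fw.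
  (* As [u] is adjacent to [v], which is in [W], it could only force [v], now dropped. *)
  have fu : f != u.
    by apply: contra_neq wv => fu; apply/esym/(Wf _ _ f) => //; rewrite fu.
  split; first by apply: contraNneq fW => ->.
  by move=> y _; rewrite (negPf fu) fw // [v == w]eq_sym (negPf wv) andbF.
have [uW|uW] := boolP (u \in W).
  exists (W :\ u); rewrite subsetDl leq_cardsD1 !inE (negPf vW) andbF; split=> // w f.
  rewrite !inE => /andP[wu wW] fW fw; split.
    by apply: contra_neq wu => fv; apply/esym/(Wf _ _ f) => //; rewrite fv adj_sym.
  move=> y; rewrite !inE => /andP[/negPf-> _]; rewrite orbF.
  by apply/negP => /andP[/eqP fu]; rewrite fu uW in fW.
have yu y : y \in W -> y == u = false by move=> yW; apply: contraNF uW => /eqP <-.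
have [/exists_inP[b bW /forall_inP vb]|nov] :=
  boolP [exists b in W, forall y in W, adj v y == (y == b)].
  exists (W :\ b); rewrite subsetDl leq_cardsD1 !inE (negPf vW) andbF; split=> // w f.
  rewrite !inE => /andP[wb wW] fW fw; split.
    by apply: contra wb => /eqP fv; rewrite -(eqP (vb _ wW)) -fv self.
  move=> y; rewrite !inE => /andP[yb yW].
  by rewrite (eqP (vb _ yW)) (negPf yb) andbF (yu y).
have nv w f : w \in W -> {in W, forall y, adj f y = (y == w)} -> f != v.
  move=> wW fw; apply: contra nov => /eqP <-.
  by apply/exists_inP; exists w => //; apply/forall_inP => y /fw ->.
have [/exists_inP[a aW /forall_inP ua]|nou] :=
  boolP [exists a in W, forall y in W, adj u y == (y == a)].
  exists (W :\ a); rewrite subsetDl leq_cardsD1 !inE (negPf vW) andbF; split=> // w f.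
  rewrite !inE => /andP[wa wW] fW fw; split; first exact: nv fw.
  move=> y; rewrite !inE => /andP[_ yW]; rewrite (yu y) // orbF.
  apply/negP => /andP[/eqP fu _]; move: wa.
  by rewrite -(eqP (ua _ wW)) -fu self.
exists W; split=> // w f wW fW fw; split; first exact: nv fw.
move=> y yW; rewrite (yu y) // orbF; apply/negP => /andP[/eqP fu _].
move/negP: nou; apply; rewrite -fu.
by apply/exists_inP; exists w => //; apply/forall_inP => z /fw ->.
Qed.
End ContractEdge.

Lemma has_edge_embed (G H : sgraph) (f : G -> H) :
  {mono f : a b / adj a b} -> has_edge G -> has_edge H.
Proof. by move=> fE [a [b ab]]; exists (f a), (f b); rewrite fE. Qed.

(** * Edge subdivision *)

Section SubdivideEdge.
Variables (G : sgraph) (u v : G).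
Hypothesis uv : adj u v.

Lemma subdivide_adj_new : @adj (subdivide_edge u v) (Some u) None.
Proof. by rewrite /= eqxx. Qed.

(** Contracting one half of the subdivided edge gives back [G] up to isomorphism. *)
Lemma force_num_contract_subdivide :
  force_num (@contract_edge (subdivide_edge u v) (Some u) None) = force_num G.
Proof.
set H := contract_edge _ _.
pose f (y : G) : H := Sub (Some y) isT.
pose g (y : H) : G := odflt u (val y).
have fK : cancel f g by [].
have gK : cancel g f by move=> [[y|] //= p]; apply/val_inj.
have fE : {mono f : a b / adj a b}.
  move=> a b; rewrite contract_adjE ?subdivide_adj_new // -val_eqE.
  (* The removed edge returns because [Some u] inherits the edge from [None] to [Some v]. *)
  change ((Some a != Some b) && [|| del_edge_adj u v a b,
     (Some a == Some u) && ((b == u) || (b == v))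
     | (Some b == Some u) && ((a == u) || (a == v))] = adj a b).
  rewrite !(inj_eq Some_inj) /del_edge_adj eq_set2.
  have uv' := uv; have := uv; rewrite adj_sym => vu.
  case: (a =P b) => [->|ab] /=; first by rewrite adj_irr.
  case: (a =P u) => [au|_] /=; case: (b =P v) => [bv|_] /=;
    case: (a =P v) => [av|_] /=; case: (b =P u) => [bu|_] /=; subst;
    rewrite ?andbT ?orbT ?orbF ?andbF //=.
apply/eqP; rewrite eqn_leq (force_num_embed (can_inj fK) fE).
rewrite (@force_num_embed _ _ g (can_inj gK)) // => a b.
by rewrite -fE !gK.
Qed.
End SubdivideEdge.

Lemma card_neq (T : finType) (v : T) : #|{: {y : T | y != v}}| = #|T|.-1.
Proof. by rewrite card_sig -(cardC1 v); apply: eq_card. Qed.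

(** * Small graphs attaining the bounds *)

Section ListGraph.
Variables (n : nat) (s : seq (nat * nat)).
Let e : rel 'I_n := fun a b =>
  (a != b) && (((a : nat, b : nat) \in s) || ((b : nat, a : nat) \in s)).
Let e_sym : symmetric e.
Proof. by move=> a b; rewrite /e eq_sym orbC. Qed.
Let e_irr : irreflexive e.
Proof. by move=> a; rewrite /e eqxx. Qed.
Definition list_graph : sgraph := SGraph e_sym e_irr.
End ListGraph.

Definition path2 := list_graph 2 [:: (0, 1)].
Definition path3 := list_graph 3 [:: (0, 1); (1, 2)].
Definition path4 := list_graph 4 [:: (0, 1); (1, 2); (2, 3)].
(* The triangle 123 with the pendant vertex 0 attached to 1. *)
Definition paw := list_graph 4 [:: (0, 1); (1, 2); (2, 3); (1, 3)].

Local Notation vtx n k := (@Ordinal n k isT).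

Lemma force_num_path4 : 2 <= force_num path4.
Proof.
by apply/force_num_ge2P; exists (vtx 4 0), (vtx 4 3), (vtx 4 1), (vtx 4 2).
Qed.

(** The pattern would use all four vertices, but 1 is adjacent to every other vertex and breaks a
    required non-adjacency. *)
Lemma force_num_paw : force_num paw < 2.
Proof.
rewrite ltnNge; apply/negP => /force_num_ge2P[a [b [c [d []]]]].
by case: a => [[|[|[|[|]]]] ?] //; case: c => [[|[|[|[|]]]] ?] //;
  case: b => [[|[|[|[|]]]] ?] //; case: d => [[|[|[|[|]]]] ?].
Qed.

(** Without the edge 13 the paw is the path 0, 1, 2, 3. *)
Lemma force_num_paw_del : 2 <= force_num (@del_edge paw (vtx 4 1) (vtx 4 3)).
Proof.
by apply/force_num_ge2P; exists (vtx 4 0), (vtx 4 3), (vtx 4 1), (vtx 4 2); split;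
  rewrite //= /del_edge_adj eq_set2.
Qed.

(** Vertex 3 becomes isolated, leaving too few vertices for the pattern. *)
Lemma force_num_path4_del : force_num (@del_edge path4 (vtx 4 2) (vtx 4 3)) < 2.
Proof.
rewrite ltnNge; apply/negP => /force_num_ge2P[a [b [c [d []]]]].
rewrite /= /del_edge_adj !eq_set2.
by case: a => [[|[|[|[|]]]] ?] //; case: c => [[|[|[|[|]]]] ?] //;
  case: b => [[|[|[|[|]]]] ?] //; case: d => [[|[|[|[|]]]] ?].
Qed.

Lemma force_num_path3_subdivide :
  2 <= force_num (@subdivide_edge path3 (vtx 3 1) (vtx 3 2)).
Proof.
by apply/force_num_ge2P;
  exists (Some (vtx 3 0)), (Some (vtx 3 2)), (Some (vtx 3 1)), None;
  split; rewrite //= /del_edge_adj eq_set2.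
Qed.

Lemma has_edge_adj (G : sgraph) (a b : G) : adj a b -> has_edge G.
Proof. by exists a, b. Qed.

Local Open Scope ereal_scope.

Theorem proposition3p14 :
  (forall (G : sgraph) (x : G), has_edge (del_vertex x) ->
     th_star G - 1 <= th_star (del_vertex x) <= th_star G)
  /\
  (forall (G : sgraph) (u v : G), adj u v -> has_edge (del_edge u v) ->
     th_star G - 1 <= th_star (del_edge u v) <= th_star G + 1)
  /\
  (forall (G : sgraph) (u v : G), adj u v -> has_edge (contract_edge u v) ->
     th_star G - 1 <= th_star (contract_edge u v) <= th_star G)
  /\
  (forall (G : sgraph) (u v : G), adj u v ->
     th_star G <= th_star (subdivide_edge u v) <= th_star G + 1)
  /\
  (exists (G : sgraph) (x : G), has_edge (del_vertex x) /\
     th_star (del_vertex x) = th_star G - 1)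
  /\
  (exists (G : sgraph) (x : G), has_edge (del_vertex x) /\
     th_star (del_vertex x) = th_star G)
  /\
  (exists (G : sgraph) (u v : G), adj u v /\ has_edge (del_edge u v) /\
     th_star (del_edge u v) = th_star G - 1)
  /\
  (exists (G : sgraph) (u v : G), adj u v /\ has_edge (del_edge u v) /\
     th_star (del_edge u v) = th_star G + 1)
  /\
  (exists (G : sgraph) (u v : G), adj u v /\ has_edge (contract_edge u v) /\
     th_star (contract_edge u v) = th_star G - 1)
  /\
  (exists (G : sgraph) (u v : G), adj u v /\ has_edge (contract_edge u v) /\
     th_star (contract_edge u v) = th_star G)
  /\
  (exists (G : sgraph) (u v : G), adj u v /\
     th_star (subdivide_edge u v) = th_star G)
  /\
  (exists (G : sgraph) (u v : G), adj u v /\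
     th_star (subdivide_edge u v) = th_star G + 1).
Proof.
have bounds G : has_edge G -> (0 < force_num G /\ 2 * force_num G <= #|G|)%N.
  by move=> eG; rewrite force_num_gt0 // force_num_half.
have card_del (G : sgraph) (x : G) : #|del_vertex x| = #|G|.-1.
  exact: card_neq.
have card_del_edge (G : sgraph) (u v : G) : #|del_edge u v| = #|G| by [].
have card_contract (G : sgraph) (u v : G) : #|contract_edge u v| = #|G|.-1.
  exact: card_neq.
have card_subdivide (G : sgraph) (u v : G) : #|subdivide_edge u v| = #|G|.+1.
  exact: card_option.
split=> [G x eGx|].
  have eG : has_edge G by apply: (@has_edge_embed (del_vertex x) G val) eGx.
  have := bounds _ eG; have := bounds _ eGx.
  have := force_num_del_vertex_le x; have := force_num_del_vertex_ge x.
  rewrite !th_starE // card_del -EFinB !lee_fin; lia.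
split=> [G u v uv eGe|].
  have eG := has_edge_adj uv.
  have := bounds _ eG; have := bounds _ eGe.
  have := force_num_del_edge_le u v; have := force_num_del_edge_ge u v.
  rewrite !th_starE // -EFinB -EFinD !lee_fin card_del_edge; lia.
have contract (G : sgraph) (u v : G) : adj u v -> has_edge (contract_edge u v) ->
    th_star G - 1 <= th_star (contract_edge u v) <= th_star G.
  move=> uv eGe; have eG := has_edge_adj uv.
  have := bounds _ eG; have := bounds _ eGe.
  have := force_num_contract_le uv; have := force_num_contract_ge uv.
  rewrite !th_starE // card_contract -EFinB !lee_fin; lia.
split=> //.
split=> [G u v uv|].
  (* The contraction bounds are applied to the subdivided graph and its edge from [Some u] to
     [None]. *)
  have new := subdivide_adj_new u v.
  have eG := has_edge_adj uv; have eGe := has_edge_adj new.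
  have := bounds _ eG; have := bounds _ eGe.
  have := force_num_contract_le new; have := force_num_contract_ge new.
  rewrite force_num_contract_subdivide //.
  rewrite !th_starE // card_subdivide -EFinD !lee_fin; lia.
(* Positivity of [c - d] makes the truncated subtraction of 1 agree with the integer one. *)
have sub1 a b c d : (a - b = c - d - 1)%N -> (0 < c - d)%N ->
    (a - b)%N%:Z%:E = (c - d)%N%:Z%:E - 1 :> \bar int.
  by move=> *; rewrite -EFinB; congr EFin; lia.
have add1 a b c d : (a - b = c - d + 1)%N ->
    (a - b)%N%:Z%:E = (c - d)%N%:Z%:E + 1 :> \bar int.
  by move=> ->; rewrite -EFinD; congr EFin; lia.
have e2 : has_edge path2 by exists (vtx 2 0), (vtx 2 1).
have e3 : has_edge path3 by exists (vtx 3 0), (vtx 3 1).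
have e4 : has_edge path4 by exists (vtx 4 0), (vtx 4 1).
have ep : has_edge paw by exists (vtx 4 0), (vtx 4 1).
have := bounds _ e2; have := bounds _ e3; have := bounds _ e4; have := bounds _ ep.
rewrite !card_ord => bp b4 b3 b2.
have p4 := force_num_path4.
(* On the paths with 2, 3, 4 vertices and the paw, th* is 1, 2, 2, 3; on the path with 4 vertices
   minus an end edge it is 3. Each example compares two of these graphs. *)
do ![split].
- exists path3, (vtx 3 2).
  have eH : has_edge (@del_vertex path3 (vtx 3 2))
    by exists (Sub (vtx 3 0) isT), (Sub (vtx 3 1) isT).
  have H := bounds _ eH; split=> //.
  rewrite !th_starE //; move: H; rewrite card_del card_ord => ?;
    apply: sub1; lia.
- exists path4, (vtx 4 3).
  have eH : has_edge (@del_vertex path4 (vtx 4 3))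
    by exists (Sub (vtx 4 0) isT), (Sub (vtx 4 1) isT).
  have H := bounds _ eH; split=> //.
  rewrite !th_starE //; move: H; rewrite card_del card_ord => ?;
    congr (_%:Z%:E); lia.
- exists paw, (vtx 4 1), (vtx 4 3).
  have eH : has_edge (@del_edge paw (vtx 4 1) (vtx 4 3)).
    by exists (vtx 4 0), (vtx 4 1); rewrite /= /del_edge_adj eq_set2.
  have H := bounds _ eH; split=> //; split=> //.
  rewrite !th_starE //; move: H; rewrite card_del_edge card_ord => ?;
    apply: sub1;
    have := force_num_paw; have := force_num_paw_del; lia.
- exists path4, (vtx 4 2), (vtx 4 3).
  have eH : has_edge (@del_edge path4 (vtx 4 2) (vtx 4 3)).
    by exists (vtx 4 0), (vtx 4 1); rewrite /= /del_edge_adj eq_set2.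
  have H := bounds _ eH; split=> //; split=> //.
  rewrite !th_starE //; move: H; rewrite card_del_edge card_ord => ?;
    apply: add1;
    have := force_num_path4_del; lia.
- exists path3, (vtx 3 1), (vtx 3 2).
  have eH : has_edge (@contract_edge path3 (vtx 3 1) (vtx 3 2)).
    by exists (Sub (vtx 3 0) isT), (Sub (vtx 3 1) isT); rewrite contract_adjE.
  have H := bounds _ eH; split=> //; split=> //.
  rewrite !th_starE //; move: H; rewrite card_contract !card_ord => ?;
    apply: sub1; lia.
- exists path4, (vtx 4 2), (vtx 4 3).
  have eH : has_edge (@contract_edge path4 (vtx 4 2) (vtx 4 3)).
    by exists (Sub (vtx 4 0) isT), (Sub (vtx 4 1) isT); rewrite contract_adjE.
  have H := bounds _ eH; split=> //; split=> //.
  rewrite !th_starE //; move: H; rewrite card_contract !card_ord => ?;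
    congr (_%:Z%:E); lia.
- exists path3, (vtx 3 1), (vtx 3 2).
  have eH := has_edge_adj (@subdivide_adj_new path3 (vtx 3 1) (vtx 3 2)).
  have H := bounds _ eH; split=> //.
  rewrite !th_starE //; move: H; rewrite card_subdivide !card_ord => ?;
    congr (_%:Z%:E);
    have := force_num_path3_subdivide; lia.
- exists path2, (vtx 2 0), (vtx 2 1).
  have eH := has_edge_adj (@subdivide_adj_new path2 (vtx 2 0) (vtx 2 1)).
  have H := bounds _ eH; split=> //.
  rewrite !th_starE //; move: H; rewrite card_subdivide !card_ord => ?;
    apply: add1; lia.
Qed.
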